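(* Let $g(\cdot,\mathbf{p}):\Delta^n\to\mathbb{R}$ be the reduced Gibbs free energy at fixed pressure and temperature $(P,T)$, with $g\in C^0(\Delta^n)$ and Lipschitz on $\Delta^n$. Let $\{\mathbf{x}^{\alpha,i},\mathbf{x}^{\beta,i}\}_{i=1}^k$ be the experimental tie-line endpoints and let $h$, $\mathcal{M}$, $\mathcal{X}_D^\pm(\mathbf{p})$ and $\Phi(\mathbf{p})$ be as defined in the context. If $\Phi(\mathbf{p})=0$, then $\mathcal{M}(\mathbf{x};\mathbf{p})\ge 0$ for all $\mathbf{x}\in\Delta^n$, and consequently every experimental tie-line endpoint is a globally stable phase under the Gibbs tangent-plane criterion.
   Context: Simplex and energy. $\Delta^n=\{\mathbf{x}\in\mathbb{R}^n_{\ge 0}:\sum_j x_j=1\}$. $\mathbf{p}\in P\subset\mathbb{R}^m$ is a parameter vector. Data. A finite set of measured tie lines, i.e. pairs of distinct compositions $(\mathbf{x}^{\alpha,i},\mathbf{x}^{\beta,i})$ in $\Delta^n$, $i=1,\dots,k$, with direction $\mathbf{d}_i=\mathbf{x}^{\beta,i}-\mathbf{x}^{\alpha,i}\ne \mathbf{0}$. Chords, composite hyperplane, dual manifold. The chord of tie line $i$ is the affine function $$h_i(\mathbf{x})=g(\mathbf{x}^{\alpha,i},\mathbf{p})+\frac{(\mathbf{x}-\mathbf{x}^{\alpha,i})\cdot\mathbf{d}_i}{\mathbf{d}_i\cdot\mathbf{d}_i}\,[g(\mathbf{x}^{\beta,i},\mathbf{p})-g(\mathbf{x}^{\alpha,i},\mathbf{p})].$$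 The composite supporting hyperplane is $h(\mathbf{x})=\min_{1\le i\le k}h_i(\mathbf{x})$ and the dual manifold is the scalar field $\mathcal{M}(\mathbf{x};\mathbf{p})=g(\mathbf{x},\mathbf{p})-h(\mathbf{x})$. For real $r$, $[r]_-=\min(r,0)$. Defect sets (exact sets). $\mathcal{X}_D^-(\mathbf{p})=\arg\min_{\mathbf{x}\in\Delta^n}\mathcal{M}(\mathbf{x};\mathbf{p})\setminus\{\mathbf{x}^{\alpha,i},\mathbf{x}^{\beta,i}\}_{i=1}^k$ and $\mathcal{X}_D^+(\mathbf{p})=\arg\min_{\mathbf{x}\in\Delta^n}(-\mathcal{M}(\mathbf{x};\mathbf{p}))$. Objective. Fix a small offset $\epsilon>0$, and let $\mathbf{x}^i_1,\dots,\mathbf{x}^i_4$ be the points $\mathbf{x}^{\alpha,i}+\lambda\mathbf{d}_i$ for $\lambda\in\{-\epsilon,+\epsilon,1-\epsilon,1+\epsilon\}$ (assumed to lie in the domain of $g(\cdot,\mathbf{p})$). Put $$\Phi_{\text{tangent}}=\sum_{i=1}^k\sum_{l=1}^4\bigl|[g(\mathbf{x}^i_l,\mathbf{p})-h_i(\mathbf{x}^i_l)]_-\bigr|,\qquad \Phi_{\text{plane}}=\sum_{\mathbf{x}\in\mathcal{X}_D^-}\bigl|[g(\mathbf{x},\mathbf{p})-h(\mathbf{x})]_-\bigr|,$$ $$\Phi_{\text{topo}}=\sum_{\mathbf{x}\in\mathcal{X}_D^-}\|\mathbf{x}_{\text{near}}-\mathbf{x}\|_2,\qquad \Phi_{\text{local}}=\sum_{\mathbf{x}\in\mathcal{X}_D^-}\bigl\|(\mathbf{x}^+_{\text{near}},g(\mathbf{x}^+_{\text{near}},\mathbf{p}))-(\mathbf{x},g(\mathbf{x},\mathbf{p}))\bigr\|_2,$$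 where $\mathbf{x}_{\text{near}}$ is a tie-line endpoint nearest to $\mathbf{x}$ in Euclidean distance and $\mathbf{x}^+_{\text{near}}$ is an element of $\mathcal{X}_D^+$ nearest to $\mathbf{x}$ in the joint composition–energy space (Euclidean distance between the points $(\mathbf{y},g(\mathbf{y},\mathbf{p}))$). (A fifth component, $\Phi_{\text{phase}}$, is only the labelling of elements of $\arg\min\mathcal{M}$ as endpoints or as elements of $\mathcal{X}_D^-$; it contributes no numerical value.) At fixed temperature $$\Phi(\mathbf{p})=\Bigl(\tfrac1\epsilon[\Phi_{\text{tangent}}+\Phi_{\text{plane}}+\Phi_{\text{topo}}+\Phi_{\text{local}}](\mathbf{p})\Bigr)^2;$$ for a data set at several temperatures, $\Phi$ is the sum of these expressions over the temperatures, and the result applies term by term. Stability. The pair $(\mathbf{x}^{\alpha,i},\mathbf{x}^{\beta,i})$ (and hence each of its endpoints) is globally stable under the Gibbs–Michelsen tangent-plane criterion if $h_i(\mathbf{x})\le g(\mathbf{x},\mathbf{p})$ for all $\mathbf{x}\in\Delta^n$, with equality at $\mathbf{x}^{\alpha,i}$ and $\mathbf{x}^{\beta,i}$. Standing assumption: the measured tie lines are mutually consistent, meaning (1) no two chords share an endpoint composition with conflicting $g$-values, and (2) no parameter vector can render every measured pair a globally stable phase split while leaving one of the corresponding chords crossing above $g$ somewhere on the simplex.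
   Formalization: Standing assumption (2), a tautology if read literally (the stability claim then fails), is read as: no parameter vector in P makes the composite hyperplane h ≤ g on the whole simplex while some chord h_i exceeds g somewhere on the simplex. *)

(* Defs.v *)
From HB Require Import structures.
From mathcomp Require Import all_boot all_order all_algebra.
From mathcomp Require Import all_classical all_reals all_analysis.

Set Implicit Arguments.
Unset Strict Implicit.
Unset Printing Implicit Defensive.

Import Order.TTheory GRing.Theory Num.Theory.
Import numFieldNormedType.Exports.

Local Open Scope classical_set_scope.
Local Open Scope ring_scope.

Section Euclidean.
Context {R : realType}.

Definition dotv (n : nat) (u v : 'rV[R]_n) : R := \sum_j u 0 j * v 0 j.

(* The library norm on 'rV[R]_n is the sup norm; this is the 2-norm. *)
Definition norm2 (n : nat) (u : 'rV[R]_n) : R := Num.sqrt (dotv u u).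

Definition simplex (n : nat) : set 'rV[R]_n :=
  [set x | (forall j, 0 <= x 0 j) /\ \sum_j x 0 j = 1].

Definition negpart (r : R) : R := Num.min r 0.

Definition argmin (T : Type) (A : set T) (f : T -> R) : set T :=
  [set x | A x /\ forall y, A y -> f x <= f y].

(* A fixed element of A at which dist is smallest (when there is one). *)
Definition nearest (n : nat) (A : set 'rV[R]_n) (dist : 'rV[R]_n -> R) :
  'rV[R]_n := xget 0 (argmin A dist).

End Euclidean.

(* The energy g(x, p) is a total function of x, but only its values on the
   simplex matter.  There are k.+1 tie lines, so that at least one is present
   and the minimum defining the composite hyperplane makes sense. *)
Section DualManifold.
Context {R : realType} {n m k : nat}.
Variable g : 'rV[R]_n -> 'rV[R]_m -> R.
Variables xa xb : 'I_k.+1 -> 'rV[R]_n.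
Implicit Types (i j : 'I_k.+1) (x y : 'rV[R]_n) (p : 'rV[R]_m).

Definition dir i : 'rV[R]_n := xb i - xa i.

Definition chord i x p : R :=
  g (xa i) p +
  dotv (x - xa i) (dir i) / dotv (dir i) (dir i) * (g (xb i) p - g (xa i) p).

Definition composite x p : R :=
  \big[Num.min/chord ord0 x p]_(i < k.+1) chord i x p.

Definition dual_manifold x p : R := g x p - composite x p.

Definition is_endpoint i y : Prop := y = xa i \/ y = xb i.

Definition endpoints : set 'rV[R]_n := [set y | exists i, is_endpoint i y].

Definition defect_minus p : set 'rV[R]_n :=
  argmin (@simplex R n) (dual_manifold^~ p) `\` endpoints.

Definition defect_plus p : set 'rV[R]_n :=
  argmin (@simplex R n) (fun x => - dual_manifold x p).

Definition test_offsets (eps : R) : seq R :=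
  [:: - eps; eps; 1 - eps; 1 + eps].

Definition test_point i (lam : R) : 'rV[R]_n := xa i + lam *: dir i.

Definition Phi_tangent (eps : R) p : R :=
  \sum_(i < k.+1) \sum_(lam <- test_offsets eps)
    `| negpart (g (test_point i lam) p - chord i (test_point i lam) p) |.

(* The defect set may be infinite, so sums of nonnegative terms over it are
   taken in [0, +oo] (suprema of the finite partial sums). *)
Definition Phi_plane p : \bar R :=
  \esum_(x in defect_minus p) (`| negpart (g x p - composite x p) |)%:E.

Definition x_near x : 'rV[R]_n := nearest endpoints (fun y => norm2 (y - x)).

Definition Phi_topo p : \bar R :=
  \esum_(x in defect_minus p) (norm2 (x_near x - x))%:E.

Definition graph_point x p : 'rV[R]_(n + 1) := row_mx x (const_mx (g x p)).

Definition x_near_plus x p : 'rV[R]_n :=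
  nearest (defect_plus p)
    (fun y => norm2 (graph_point y p - graph_point x p)).

Definition Phi_local p : \bar R :=
  \esum_(x in defect_minus p)
    (norm2 (graph_point (x_near_plus x p) p - graph_point x p))%:E.

Definition Phi (eps : R) p : \bar R :=
  (((eps^-1)%:E *
   ((Phi_tangent eps p)%:E + Phi_plane p + Phi_topo p + Phi_local p)) ^+ 2)%E.

Definition globally_stable i p : Prop :=
  (forall x, simplex x -> chord i x p <= g x p) /\
  (forall y, is_endpoint i y -> chord i y p = g y p).

(* In the second clause, "every measured pair is a globally stable phase
   split" is understood relative to the composite supporting hyperplane, i.e.
   composite <= g on the simplex.  Reading it as globally_stable for all i
   would make the clause a tautology. *)
Definition mutually_consistent (P : set 'rV[R]_m) : Prop :=
  (forall p, P p -> forall i j y,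
     is_endpoint i y -> is_endpoint j y -> chord i y p = chord j y p) /\
  ~ (exists p, [/\ P p,
       forall x, simplex x -> composite x p <= g x p &
       exists i x, simplex x /\ g x p < chord i x p]).

End DualManifold.

(* Main.v *)
(* [Phi p = 0] forces [Phi_topo = 0]: every defect point coincides with a
   nearest endpoint, hence is an endpoint, so there are no defect points at all.
   The dual manifold is continuous on the compact simplex, so it attains its
   minimum, necessarily at an endpoint of some tie line [i]; there
   [composite <= chord i = g], so the minimum is nonnegative. Mutual consistency
   then upgrades [composite <= g] to [chord i <= g] for every [i]. *)
Require Import Defs.
From HB Require Import structures.
From mathcomp Require Import all_boot all_order all_algebra.
From mathcomp Require Import all_classical all_reals all_analysis.

Set Implicit Arguments.
Unset Strict Implicit.
Unset Printing Implicit Defensive.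

Import Order.TTheory GRing.Theory Num.Theory.
Import numFieldNormedType.Exports.

Local Open Scope classical_set_scope.
Local Open Scope ring_scope.

(** The singleton [[set x]] is a finite subset of [D], so [a x] is one of the partial sums whose
    supremum is the total. *)
Lemma esum_eq0_eq0 (R : realType) (T : choiceType) (D : set T)
    (a : T -> \bar R) (x : T) :
  (forall y, D y -> 0 <= a y)%E -> (\esum_(y in D) a y = 0)%E -> D x ->
  a x = 0%E.
Proof.
move=> a0 sum0 Dx; apply/eqP; rewrite eq_le a0 // andbT -sum0.
apply: esum_ge; exists [set x]; last by rewrite fsbig_set1.
by split; [exact: finite_set1 | move=> y ->].
Qed.

Lemma dotvv_ge0 (R : realType) n (u : 'rV[R]_n) : 0 <= dotv u u.
Proof. by apply: sumr_ge0 => j _; rewrite -expr2 sqr_ge0. Qed.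

Lemma dotvv_eq0 (R : realType) n (u : 'rV[R]_n) : (dotv u u == 0) = (u == 0).
Proof.
apply/eqP/eqP => [|->]; last by apply: big1 => j _; rewrite mxE mul0r.
move=> /psumr_eq0P u0; apply/rowP => j; rewrite mxE.
by apply/eqP; rewrite -sqrf_eq0 expr2 u0 // => l _; rewrite -expr2 sqr_ge0.
Qed.

(** [Num.sqrt] vanishes at every nonpositive real; [dotvv_ge0] excludes the negative ones. *)
Lemma norm2_eq0 (R : realType) n (u : 'rV[R]_n) : (norm2 u == 0) = (u == 0).
Proof. by rewrite sqrtr_eq0 le_eqVlt ltNge dotvv_ge0 orbF dotvv_eq0. Qed.

Lemma continuous_sum (R : realType) (T : topologicalType) (I : finType)
    (f : I -> T -> R) :
  (forall i, continuous (f i)) -> continuous (fun x => \sum_i f i x).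
Proof.
move=> fc x; have nx : Filter (nbhs x) by exact: nbhs_filter.
by apply: (cvg_big (F := nbhs x) add_continuous) => i _; exact: fc.
Qed.

Lemma simplex_closed (R : realType) n : closed (@simplex R n).
Proof.
have -> : @simplex R n =
    \bigcap_j [set x : 'rV[R]_n | 0 <= x 0 j] `&` [set x | \sum_j x 0 j = 1].
  by apply/seteqP; split => x [x0 x1]; split => // j; [move=> _|]; exact: x0.
apply: closedI.
  apply: closed_bigI => j _.
  apply: (preimage_closed (D := [set y : R | 0 <= y])); last exact: closed_ge.
  by move=> x _; exact: coord_continuous.
apply: (preimage_closed (f := fun x : 'rV[R]_n => \sum_j x 0 j)
                    (D := [set y : R | y = 1])); last exact: closed_eq.
by move=> x _; apply: continuous_sum => j; exact: coord_continuous.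
Qed.

Lemma simplex_compact (R : realType) n : compact (@simplex R n).
Proof.
apply: (subclosed_compact (@simplex_closed R n)
          (rV_compact (fun=> @segment_compact R 0 1))).
(* The simplex lies in the unit cube: a coordinate is at most the sum of all of them, the others
   being nonnegative. *)
move=> x [x0 x1] j /=; rewrite in_itv /= x0 -x1 (bigD1 j) //= lerDl.
by apply: sumr_ge0.
Qed.

(** The default value [f0] depends on the point because [composite] takes its minimum with default
    [chord ord0]. *)
Lemma continuous_bigmin (R : realType) (T : topologicalType) (I : Type)
    (r : seq I) (f0 : T -> R) (f : I -> T -> R) :
  continuous f0 -> (forall i, continuous (f i)) ->
  continuous (fun x => \big[Num.min/f0 x]_(i <- r) f i x).
Proof.
move=> f0c fc; elim: r => [|i r IH].
  by under eq_fun do rewrite big_nil.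
under eq_fun do rewrite big_cons.
by move=> x; apply: (@continuous_min R T (f i)); [exact: fc | exact: IH].
Qed.

Section TieLines.
Context {R : realType} {n m k : nat}.
Variable g : 'rV[R]_n -> 'rV[R]_m -> R.
Variables xa xb : 'I_k.+1 -> 'rV[R]_n.
Implicit Types (i : 'I_k.+1) (x y : 'rV[R]_n) (p : 'rV[R]_m).

Lemma chord_continuous i p : continuous (fun x => chord g xa xb i x p).
Proof.
have dotc : continuous (fun x => dotv (x - xa i) (dir xa xb i)).
  apply: continuous_sum => j x.
  under eq_fun do rewrite !mxE.
  apply: (@continuousM R _ (fun y : 'rV[R]_n => y 0 j - xa i 0 j) (cst _));
    last exact: cst_continuous.
  apply: (@continuousB R R _ (fun y : 'rV[R]_n => y 0 j) (cst (xa i 0 j)));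
    [exact: coord_continuous | exact: cst_continuous].
set d := fun x => _ in dotc.
pose c := (dotv (dir xa xb i) (dir xa xb i))^-1 * (g (xb i) p - g (xa i) p).
have -> : (fun x => chord g xa xb i x p) = cst (g (xa i) p) + d * cst c.
  by apply/funext => x; rewrite /chord -mulrA.
move=> x; apply: continuousD; first exact: cst_continuous.
by apply: continuousM; [exact: dotc | exact: cst_continuous].
Qed.

Lemma dual_manifold_continuous p :
  {within @simplex R n, continuous (g^~ p)} ->
  {within @simplex R n, continuous ((dual_manifold g xa xb)^~ p)}.
Proof.
move=> gc; apply: (within_continuousB gc); apply: continuous_subspaceT.
by apply: continuous_bigmin => [|i]; exact: chord_continuous.
Qed.

(** The projection coefficient is 0 at [xa i] and 1 at [xb i]; the latter needs a nonzero direction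
    to divide by. *)
Lemma chord_endpoint i y p :
  xa i <> xb i -> is_endpoint xa xb i y -> chord g xa xb i y p = g y p.
Proof.
move=> ab [->|->]; rewrite /chord.
  have -> : xa i - xa i = 0 by rewrite subrr.
  have -> : dotv 0 (dir xa xb i) = 0 by apply: big1 => j _; rewrite mxE mul0r.
  by rewrite !mul0r addr0.
rewrite divff ?mul1r; first by rewrite addrC subrK.
by rewrite dotvv_eq0 subr_eq0 eq_sym; apply/eqP.
Qed.

Lemma composite_le_chord i x p : composite g xa xb x p <= chord g xa xb i x p.
Proof. exact: bigmin_le. Qed.

Lemma x_near_endpoint x : endpoints xa xb (x_near xa xb x).
Proof.
(* [xget] returns the default 0 on an empty set, so a nearest endpoint must be shown to exist. The
   endpoints are indexed by the finite type ['I_k.+1 * bool], on which the distance attains its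
   minimum. *)
rewrite /x_near /nearest; set A := argmin _ _.
suff : exists y, A y by move=> /(xgetPex 0)[].
pose e (c : 'I_k.+1 * bool) := if c.2 then xa c.1 else xb c.1.
have [c _ cmin] := @Order.TotalTheory.arg_minP _ _ _ (ord0, true) predT
  (fun c => norm2 (e c - x)) isT.
exists (e c); split; first by exists c.1; rewrite /e; case: c.2; [left|right].
by move=> _ [i [->|->]]; [exact: (cmin (i, true)) | exact: (cmin (i, false))].
Qed.

(** The factor [eps^-1] is nonzero, so the sum of the four components is zero; each is nonnegative
    in the extended reals, so no cancellation can occur. *)
Lemma Phi_eq0_topo eps p : 0 < eps ->
  Phi g xa xb eps p = 0%E -> Phi_topo g xa xb p = 0%E.
Proof.
move=> eps0 /eqP; rewrite /Phi expe_eq0 mule_eq0 /= eqe invr_eq0 gt_eqF //=.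
have t0 : (0 <= (Phi_tangent g xa xb eps p)%:E)%E.
  by rewrite lee_fin; apply: sumr_ge0 => i _; apply: sumr_ge0.
have pl0 : (0 <= Phi_plane g xa xb p)%E.
  by apply: esum_ge0 => x _; rewrite lee_fin.
have to0 : (0 <= Phi_topo g xa xb p)%E.
  by apply: esum_ge0 => x _; rewrite lee_fin sqrtr_ge0.
have lo0 : (0 <= Phi_local g xa xb p)%E.
  by apply: esum_ge0 => x _; rewrite lee_fin sqrtr_ge0.
by rewrite !padde_eq0 ?adde_ge0 // => /andP[/andP[_ /eqP]].
Qed.

Lemma Phi_topo_eq0_defect p :
  Phi_topo g xa xb p = 0%E -> defect_minus g xa xb p = set0.
Proof.
move=> topo0; apply/seteqP; split => // x Dx.
have /eqP : (norm2 (x_near xa xb x - x))%:E = 0%E.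
  by apply: (esum_eq0_eq0 _ topo0 Dx) => y _; rewrite lee_fin sqrtr_ge0.
rewrite eqe norm2_eq0 subr_eq0 => /eqP near_x.
by case: Dx => _; apply; rewrite -near_x; exact: x_near_endpoint.
Qed.

End TieLines.

Theorem theorem4 (R : realType) (n m k : nat)
    (P : set 'rV[R]_m) (g : 'rV[R]_n -> 'rV[R]_m -> R)
    (xa xb : 'I_k.+1 -> 'rV[R]_n) (eps : R) (p : 'rV[R]_m)
    (hxa : forall i, simplex (xa i)) (hxb : forall i, simplex (xb i))
    (hab : forall i, xa i <> xb i)
    (heps : 0 < eps)
    (htest : forall i lam, lam \in test_offsets eps ->
       simplex (test_point xa xb i lam))
    (hcons : mutually_consistent g xa xb P)
    (hp : P p)
    (hcont : {within @simplex R n, continuous (g^~ p)})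
    (hlip : [lipschitz g x p | x in @simplex R n])
    (hPhi : Phi g xa xb eps p = 0%E) :
  (forall x, simplex x -> 0 <= dual_manifold g xa xb x p) /\
  (forall i, globally_stable g xa xb i p).
Proof.
have defect0 := Phi_topo_eq0_defect (Phi_eq0_topo heps hPhi).
(* The endpoint [xa ord0] shows that the simplex is nonempty, as the extreme value theorem
   requires. *)
have [c /set_mem sc cmin] := EVT_min_rV (ex_intro _ _ (hxa ord0))
  (@simplex_compact R n) (dual_manifold_continuous (xa := xa) (xb := xb) hcont).
have M0 x : simplex x -> 0 <= dual_manifold g xa xb x p.
  move=> sx; apply: le_trans (cmin _ (mem_set sx)).
  have [i ci] : endpoints xa xb c.
    apply: contrapT => nc; suff : defect_minus g xa xb p c by rewrite defect0.
    by split=> //; split=> // y sy; apply: cmin; exact: mem_set.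
  rewrite subr_ge0 -(chord_endpoint g p (hab i) ci).
  exact: composite_le_chord.
split=> // i; split=> [x sx|y]; last exact: chord_endpoint.
(* If chord [i] exceeded [g] at [x], then [p], [i] and [x] would realise the configuration that the
   second consistency clause forbids. *)
rewrite leNgt; apply/negP => gx; case: hcons => _; apply.
by exists p; split=> // [y sy|]; [rewrite -subr_ge0 M0 | exists i, x].
Qed.
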